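(* Let $\mathcal{C}$ be a premodular fusion category and $\mathcal{D}\subset\mathcal{C}$ a Tannakian subcategory of $\mathcal{C}$ with $\mathrm{rank}(\mathcal{D})+2=\mathrm{rank}(\mathcal{C})$. Then at least one of the following is true: (1) $\mathcal{C}$ is symmetrically braided, (2) $\mathcal{D}\subsetneq C_\mathcal{C}(\mathcal{C})$ and $C_\mathcal{C}(\mathcal{C})$ is a maximal fusion subcategory of $\mathcal{C}$, or (3) $C_\mathcal{C}(\mathcal{C})\subset\mathcal{D}$.
   Context: Fusion categories are over $\mathbb{C}$; rank is the number of isomorphism classes of simple objects. A premodular fusion category is a braided fusion category equipped with a spherical structure. For a braided fusion category $\mathcal{C}$ with braiding $\sigma$, the symmetric center $C_\mathcal{C}(\mathcal{C})$ is the fusion subcategory of objects $X$ with $\sigma_{Y,X}\sigma_{X,Y}=\mathrm{id}_{X\otimes Y}$ for all $Y\in\mathcal{C}$; $\mathcal{C}$ is symmetrically braided if $C_\mathcal{C}(\mathcal{C})=\mathcal{C}$. A fusion subcategory of $\mathcal{C}$ is Tannakian if, with the braiding of $\mathcal{C}$, it is braided equivalent to $\mathrm{Rep}(G)$ with its standard symmetric braiding for some finite group $G$. A maximal fusion subcategory $\mathcal{E}\subset\mathcal{C}$ means a proper fusion subcategory of maximal possible rank, i.e. $\mathrm{rank}(\mathcal{E})+1=\mathrm{rank}(\mathcal{C})$. *)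

(* Defs.v *)
From HB Require Import structures.
From mathcomp Require Import all_boot all_order all_algebra all_fingroup.
From mathcomp Require Import all_character.
From mathcomp Require Import mxtens complex.
From mathcomp Require Import reals.

Set Implicit Arguments.
Unset Strict Implicit.
Unset Printing Implicit Defensive.

Import GRing.Theory.
Local Open Scope ring_scope.

Declare Scope cat_scope.
Delimit Scope cat_scope with cat.
Local Open Scope cat_scope.

Reserved Notation "g ∘ f" (at level 40, left associativity).
Reserved Notation "X ⊗ Y" (at level 39, left associativity).
Reserved Notation "f ⊗m g" (at level 39, left associativity).

(* Taking Hom spaces in vectType makes them finite-dimensional. *)
Record linCat (K : fieldType) := LinCat {
  obj :> Type;
  mor : obj -> obj -> vectType K;
  idm : forall X, mor X X;
  compm : forall X Y Z, mor Y Z -> mor X Y -> mor X Z;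
  comp1m : forall X Y (f : mor X Y), compm (idm Y) f = f;
  compm1 : forall X Y (f : mor X Y), compm f (idm X) = f;
  compA : forall X Y Z W (h : mor Z W) (g : mor Y Z) (f : mor X Y),
    compm h (compm g f) = compm (compm h g) f;
  comp_linl : forall X Y Z (f : mor X Y), linear (fun g : mor Y Z => compm g f);
  comp_linr : forall X Y Z (g : mor Y Z), linear (fun f : mor X Y => compm g f)
}.
Arguments idm {K C} X : rename.
Arguments compm {K C X Y Z} g f : rename.
Notation "g ∘ f" := (compm g f) : cat_scope.

Section LinCatTheory.
Variables (K : fieldType) (C : linCat K).
Implicit Types X Y Z : C.

Definition inverses X Y (f : mor X Y) (g : mor Y X) : Prop :=
  g ∘ f = idm X /\ f ∘ g = idm Y.

Definition is_iso X Y (f : mor X Y) : Prop := exists g, inverses f g.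

Definition isomorphic X Y : Prop := exists f : mor X Y, is_iso f.

Definition is_mono X Y (f : mor X Y) : Prop :=
  forall Z (g h : mor Z X), f ∘ g = f ∘ h -> g = h.

Definition is_epi X Y (f : mor X Y) : Prop :=
  forall Z (g h : mor Y Z), g ∘ f = h ∘ f -> g = h.

Definition is_kernel X Y Z (f : mor X Y) (k : mor Z X) : Prop :=
  f ∘ k = 0 /\
  forall W (g : mor W X), f ∘ g = 0 -> exists! h : mor W Z, k ∘ h = g.

Definition is_cokernel X Y Z (f : mor X Y) (c : mor Y Z) : Prop :=
  c ∘ f = 0 /\
  forall W (g : mor Y W), g ∘ f = 0 -> exists! h : mor Z W, h ∘ c = g.

Definition is_zero X : Prop :=
  forall Y, (forall f : mor X Y, f = 0) /\ (forall f : mor Y X, f = 0).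

(* S is the direct sum of the finite family Xs; for n = 0 this says that S is
   a zero object. *)
Definition is_dsum n (Xs : 'I_n -> C) (S : C) : Prop :=
  exists (i : forall j, mor (Xs j) S) (p : forall j, mor S (Xs j)),
    [/\ forall j, p j ∘ i j = idm (Xs j),
        forall j k, j != k -> p j ∘ i k = 0
      & \sum_j (i j ∘ p j) = idm S].

Record abelian_cat : Prop := AbelianCat {
  ab_dsum : forall n (Xs : 'I_n -> C), exists S, is_dsum Xs S;
  ab_ker : forall X Y (f : mor X Y), exists Z (k : mor Z X), is_kernel f k;
  ab_coker : forall X Y (f : mor X Y), exists Z (c : mor Y Z), is_cokernel f c;
  ab_monic : forall X Y (f : mor X Y), is_mono f ->
    exists Z (g : mor Y Z), is_kernel g f;
  ab_epic : forall X Y (f : mor X Y), is_epi f ->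
    exists Z (g : mor Z X), is_cokernel g f
}.

Definition simple_obj X : Prop :=
  ~ is_zero X /\
  forall Y (f : mor Y X), is_mono f -> is_zero Y \/ is_iso f.

Definition semisimple : Prop :=
  forall X, exists n (Xs : 'I_n -> C),
    (forall j, simple_obj (Xs j)) /\ is_dsum Xs X.

(* The rank as a relation: n is the number of isomorphism classes of simple
   objects. *)
Definition has_rank (n : nat) : Prop :=
  exists S : 'I_n -> C,
    [/\ forall i, simple_obj (S i),
        forall i j, isomorphic (S i) (S j) -> i = j
      & forall X, simple_obj X -> exists i, isomorphic X (S i)].

End LinCatTheory.

Record monCat (K : fieldType) := MonCat {
  mon_lin :> linCat K;
  unitob : mon_lin;
  tens : mon_lin -> mon_lin -> mon_lin;
  tensm : forall X X' Y Y' : mon_lin,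
    mor X X' -> mor Y Y' -> mor (tens X Y) (tens X' Y');
  assoc : forall X Y Z, mor (tens (tens X Y) Z) (tens X (tens Y Z));
  assocV : forall X Y Z, mor (tens X (tens Y Z)) (tens (tens X Y) Z);
  lunit : forall X, mor (tens unitob X) X;
  lunitV : forall X, mor X (tens unitob X);
  runit : forall X, mor (tens X unitob) X;
  runitV : forall X, mor X (tens X unitob);
  tensm1 : forall X Y, tensm (idm X) (idm Y) = idm (tens X Y);
  tensm_comp : forall X X' X'' Y Y' Y''
    (f' : mor X' X'') (f : mor X X') (g' : mor Y' Y'') (g : mor Y Y'),
    tensm (f' ∘ f) (g' ∘ g) = tensm f' g' ∘ tensm f g;
  tensm_linl : forall X X' Y Y' (g : mor Y Y'),
    linear (fun f : mor X X' => tensm f g);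
  tensm_linr : forall X X' Y Y' (f : mor X X'),
    linear (fun g : mor Y Y' => tensm f g);
  assocK : forall X Y Z, inverses (assoc X Y Z) (assocV X Y Z);
  lunitK : forall X, inverses (lunit X) (lunitV X);
  runitK : forall X, inverses (runit X) (runitV X);
  assoc_nat : forall X X' Y Y' Z Z'
    (f : mor X X') (g : mor Y Y') (h : mor Z Z'),
    assoc X' Y' Z' ∘ tensm (tensm f g) h =
    tensm f (tensm g h) ∘ assoc X Y Z;
  lunit_nat : forall X X' (f : mor X X'),
    lunit X' ∘ tensm (idm unitob) f = f ∘ lunit X;
  runit_nat : forall X X' (f : mor X X'),
    runit X' ∘ tensm f (idm unitob) = f ∘ runit X;
  pentagon : forall X Y Z W,
    assoc X Y (tens Z W) ∘ assoc (tens X Y) Z W =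
    tensm (idm X) (assoc Y Z W) ∘ assoc X (tens Y Z) W
      ∘ tensm (assoc X Y Z) (idm W);
  triangle : forall X Y,
    tensm (idm X) (lunit Y) ∘ assoc X unitob Y = tensm (runit X) (idm Y)
}.
Arguments unitob {K C} : rename.
Arguments tens {K C} X Y : rename.
Arguments tensm {K C X X' Y Y'} f g : rename.
Arguments assoc {K C} X Y Z : rename.
Arguments assocV {K C} X Y Z : rename.
Arguments lunit {K C} X : rename.
Arguments lunitV {K C} X : rename.
Arguments runit {K C} X : rename.
Arguments runitV {K C} X : rename.
Notation "X ⊗ Y" := (tens X Y) : cat_scope.
Notation "f ⊗m g" := (tensm f g) : cat_scope.

Record braiding (K : fieldType) (C : monCat K) := Braiding {
  braid :> forall X Y : C, mor (X ⊗ Y) (Y ⊗ X);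
  braid_iso : forall X Y, is_iso (braid X Y);
  braid_nat : forall (X X' Y Y' : C) (f : mor X X') (g : mor Y Y'),
    braid X' Y' ∘ (f ⊗m g) = (g ⊗m f) ∘ braid X Y;
  hexagon1 : forall X Y Z : C,
    assoc Y Z X ∘ braid X (Y ⊗ Z) ∘ assoc X Y Z =
    (idm Y ⊗m braid X Z) ∘ assoc Y X Z ∘ (braid X Y ⊗m idm Z);
  hexagon2 : forall X Y Z : C,
    assocV Z X Y ∘ braid (X ⊗ Y) Z ∘ assocV X Y Z =
    (braid X Z ⊗m idm Y) ∘ assocV X Z Y ∘ (idm X ⊗m braid Y Z)
}.

Record brFunctor (K : fieldType) (C D : monCat K)
    (c : braiding C) (d : braiding D) := BrFunctor {
  fobj :> C -> D;
  fmap : forall X Y : C, mor X Y -> mor (fobj X) (fobj Y);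
  fmu : forall X Y : C, mor (fobj X ⊗ fobj Y) (fobj (X ⊗ Y));
  feps : mor unitob (fobj unitob);
  fmap_lin : forall X Y : C, linear (@fmap X Y);
  fmap1 : forall X : C, fmap (idm X) = idm (fobj X);
  fmap_comp : forall (X Y Z : C) (g : mor Y Z) (f : mor X Y),
    fmap (g ∘ f) = fmap g ∘ fmap f;
  fmu_iso : forall X Y : C, is_iso (fmu X Y);
  feps_iso : is_iso feps;
  fmu_nat : forall (X X' Y Y' : C) (f : mor X X') (g : mor Y Y'),
    fmu X' Y' ∘ (fmap f ⊗m fmap g) = fmap (f ⊗m g) ∘ fmu X Y;
  fmu_assoc : forall X Y Z : C,
    fmap (assoc X Y Z) ∘ fmu (X ⊗ Y) Z ∘ (fmu X Y ⊗m idm (fobj Z)) =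
    fmu X (Y ⊗ Z) ∘ (idm (fobj X) ⊗m fmu Y Z)
      ∘ assoc (fobj X) (fobj Y) (fobj Z);
  fmu_lunit : forall X : C,
    fmap (lunit X) ∘ fmu unitob X ∘ (feps ⊗m idm (fobj X)) = lunit (fobj X);
  fmu_runit : forall X : C,
    fmap (runit X) ∘ fmu X unitob ∘ (idm (fobj X) ⊗m feps) = runit (fobj X);
  fmu_braid : forall X Y : C,
    fmap (c X Y) ∘ fmu X Y = fmu Y X ∘ d (fobj X) (fobj Y)
}.
Arguments fmap {K C D c d} F {X Y} f : rename.

Definition braided_equivalent (K : fieldType) (C D : monCat K)
    (c : braiding C) (d : braiding D) : Prop :=
  exists F : brFunctor c d,
    (forall X Y : C, bijective (fun f : mor X Y => fmap F f)) /\
    (forall Y : D, exists X : C, isomorphic (F X) Y).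

Section FullSub.
Variables (K : fieldType).

Definition sub_lin (C : linCat K) (P : C -> Prop) : linCat K :=
  @LinCat K {X : C | P X} (fun X Y => mor (sval X) (sval Y))
    (fun X => idm (sval X)) (fun X Y Z g f => g ∘ f)
    (fun X Y f => comp1m f) (fun X Y f => compm1 f)
    (fun X Y Z W h g f => compA h g f)
    (fun X Y Z f => @comp_linl K C (sval X) (sval Y) (sval Z) f)
    (fun X Y Z g => @comp_linr K C (sval X) (sval Y) (sval Z) g).

Variables (C : monCat K) (P : C -> Prop).
Hypothesis P1 : P unitob.
Hypothesis PM : forall X Y, P X -> P Y -> P (X ⊗ Y).

Definition sub_mon : monCat K :=
  @MonCat K (sub_lin P) (exist P unitob P1)
    (fun X Y => exist P (sval X ⊗ sval Y) (PM (svalP X) (svalP Y)))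
    (fun X X' Y Y' f g => tensm f g)
    (fun X Y Z => assoc (sval X) (sval Y) (sval Z))
    (fun X Y Z => assocV (sval X) (sval Y) (sval Z))
    (fun X => lunit (sval X)) (fun X => lunitV (sval X))
    (fun X => runit (sval X)) (fun X => runitV (sval X))
    (fun X Y => tensm1 (sval X) (sval Y))
    (fun X X' X'' Y Y' Y'' f' f g' g => tensm_comp f' f g' g)
    (fun X X' Y Y' g => @tensm_linl K C (sval X) (sval X') _ _ g)
    (fun X X' Y Y' f => @tensm_linr K C _ _ (sval Y) (sval Y') f)
    (fun X Y Z => assocK (sval X) (sval Y) (sval Z))
    (fun X => lunitK (sval X)) (fun X => runitK (sval X))
    (fun X X' Y Y' Z Z' f g h => assoc_nat f g h)
    (fun X X' f => lunit_nat f) (fun X X' f => runit_nat f)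
    (fun X Y Z W => pentagon (sval X) (sval Y) (sval Z) (sval W))
    (fun X Y => triangle (sval X) (sval Y)).

Definition sub_braiding (c : braiding C) : braiding sub_mon :=
  @Braiding K sub_mon (fun X Y => c (sval X) (sval Y))
    (fun X Y => braid_iso c (sval X) (sval Y))
    (fun X X' Y Y' f g => braid_nat c f g)
    (fun X Y Z => hexagon1 c (sval X) (sval Y) (sval Z))
    (fun X Y Z => hexagon2 c (sval X) (sval Y) (sval Z)).

End FullSub.

(* Objects are the matrix representations of G, acting on row vectors; a
   morphism from U to V is a matrix A with U g *m A = A *m V g for g in G, so
   the composite of A followed by B is A *m B. The structural isomorphisms are
   the matrices of the evident maps between index sets. *)
Section Rep.
Variables (K : fieldType).

Definition fmx m n (f : 'I_m -> 'I_n) : 'M[K]_(m, n) :=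
  \matrix_(i, j) (f i == j)%:R.

Lemma mulfmx m n p (f : 'I_m -> 'I_n) (A : 'M[K]_(n, p)) :
  fmx f *m A = \matrix_(i, j) A (f i) j.
Proof.
apply/matrixP=> i j; rewrite !mxE (bigD1 (f i)) //= mxE eqxx mul1r.
rewrite big1 ?addr0 // => k kf; rewrite mxE.
by rewrite eq_sym (negbTE kf) mul0r.
Qed.

Lemma fmxM m n p (f : 'I_m -> 'I_n) (g : 'I_n -> 'I_p) :
  fmx f *m fmx g = fmx (g \o f).
Proof. by rewrite mulfmx; apply/matrixP=> i j; rewrite !mxE. Qed.

Lemma eq_fmx m n (f g : 'I_m -> 'I_n) : f =1 g -> fmx f = fmx g.
Proof. by move=> fg; apply/matrixP=> i j; rewrite !mxE fg. Qed.

Lemma fmx1 n (f : 'I_n -> 'I_n) : f =1 id -> fmx f = 1%:M.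
Proof. by move=> fid; apply/matrixP=> i j; rewrite !mxE fid. Qed.

Lemma fmx_nat m n p q (a : 'I_m -> 'I_n) (b : 'I_p -> 'I_q) b'
    (M : 'M[K]_(m, p)) (N : 'M[K]_(n, q)) :
  cancel b b' -> cancel b' b ->
  (forall i k, M i k = N (a i) (b k)) -> M *m fmx b = fmx a *m N.
Proof.
move=> bK b'K MN; rewrite mulfmx; apply/matrixP=> i j.
rewrite !mxE (bigD1 (b' j)) //= !mxE b'K eqxx mulr1 MN b'K.
rewrite big1 ?addr0 // => k kj; rewrite mxE.
case: eqP => [bk|_]; last by rewrite mulr0.
by rewrite -bk bK eqxx in kj.
Qed.

Definition tens_fun m n p q (f : 'I_m -> 'I_n) (g : 'I_p -> 'I_q)
    (k : 'I_(m * p)) : 'I_(n * q) :=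
  mxtens_index (f (mxtens_unindex k).1, g (mxtens_unindex k).2).

Lemma mxtens_index_eq m n (x y : 'I_m * 'I_n) :
  (mxtens_index x == mxtens_index y) = (x == y).
Proof. by rewrite (can_eq (@mxtens_indexK m n)). Qed.

Lemma fmx_tens m n p q (f : 'I_m -> 'I_n) (g : 'I_p -> 'I_q) :
  fmx f *t fmx g = fmx (tens_fun f g).
Proof.
apply/matrixP=> i j; case: (mxtens_indexP j) => j1 j2.
rewrite !mxE mxtens_indexK /tens_fun mxtens_index_eq xpair_eqE /=.
by case: (_ == j1); case: (_ == j2); rewrite /= ?mulr1 ?mulr0.
Qed.

Lemma tens1fmx m n p (g : 'I_n -> 'I_p) :
  (1%:M : 'M[K]_m) *t fmx g = fmx (tens_fun id g).
Proof. by rewrite -fmx_tens (@fmx1 _ id). Qed.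

Lemma fmxtens1 m n p (f : 'I_m -> 'I_n) :
  fmx f *t (1%:M : 'M[K]_p) = fmx (tens_fun f id).
Proof. by rewrite -fmx_tens (@fmx1 _ id). Qed.

Lemma tens1mx1 m n : (1%:M : 'M[K]_m) *t (1%:M : 'M[K]_n) = 1%:M.
Proof.
rewrite -[X in X *t _](@fmx1 _ id) // fmxtens1; apply: fmx1 => k.
by case: (mxtens_indexP k) => i j; rewrite /tens_fun mxtens_indexK.
Qed.

Definition assoc_fun m n p (k : 'I_(m * n * p)) : 'I_(m * (n * p)) :=
  let: (ij, l) := mxtens_unindex k in
  let: (i, j) := mxtens_unindex ij in
  mxtens_index (i, mxtens_index (j, l)).

Definition assocV_fun m n p (k : 'I_(m * (n * p))) : 'I_(m * n * p) :=
  let: (i, jl) := mxtens_unindex k in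
  let: (j, l) := mxtens_unindex jl in
  mxtens_index (mxtens_index (i, j), l).

Definition lunit_fun n (k : 'I_(1 * n)) : 'I_n := (mxtens_unindex k).2.
Definition lunitV_fun n (k : 'I_n) : 'I_(1 * n) := mxtens_index (ord0, k).
Definition runit_fun n (k : 'I_(n * 1)) : 'I_n := (mxtens_unindex k).1.
Definition runitV_fun n (k : 'I_n) : 'I_(n * 1) := mxtens_index (k, ord0).
Definition braid_fun m n (k : 'I_(m * n)) : 'I_(n * m) :=
  mxtens_index ((mxtens_unindex k).2, (mxtens_unindex k).1).

Lemma assoc_funE m n p (i : 'I_m) (j : 'I_n) (l : 'I_p) :
  assoc_fun (mxtens_index (mxtens_index (i, j), l)) =
  mxtens_index (i, mxtens_index (j, l)).
Proof. by rewrite /assoc_fun !mxtens_indexK. Qed.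

Lemma assocV_funE m n p (i : 'I_m) (j : 'I_n) (l : 'I_p) :
  assocV_fun (mxtens_index (i, mxtens_index (j, l))) =
  mxtens_index (mxtens_index (i, j), l).
Proof. by rewrite /assocV_fun !mxtens_indexK. Qed.

Lemma lunit_funE n (i : 'I_1) (j : 'I_n) :
  lunit_fun (mxtens_index (i, j)) = j.
Proof. by rewrite /lunit_fun mxtens_indexK. Qed.

Lemma runit_funE n (i : 'I_n) (j : 'I_1) :
  runit_fun (mxtens_index (i, j)) = i.
Proof. by rewrite /runit_fun mxtens_indexK. Qed.

Lemma braid_funE m n (i : 'I_m) (j : 'I_n) :
  braid_fun (mxtens_index (i, j)) = mxtens_index (j, i).
Proof. by rewrite /braid_fun mxtens_indexK. Qed.

Lemma tens_funE m n p q (f : 'I_m -> 'I_n) (g : 'I_p -> 'I_q) i j :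
  tens_fun f g (mxtens_index (i, j)) = mxtens_index (f i, g j).
Proof. by rewrite /tens_fun mxtens_indexK. Qed.

Definition funE :=
  (assoc_funE, assocV_funE, lunit_funE, runit_funE, braid_funE, tens_funE).

Lemma assoc_funK m n p : cancel (@assoc_fun m n p) (@assocV_fun m n p).
Proof.
move=> k; case: (mxtens_indexP k) => ij l.
by case: (mxtens_indexP ij) => i j; rewrite !funE.
Qed.

Lemma assocV_funK m n p : cancel (@assocV_fun m n p) (@assoc_fun m n p).
Proof.
move=> k; case: (mxtens_indexP k) => i jl.
by case: (mxtens_indexP jl) => j l; rewrite !funE.
Qed.

Lemma lunit_funK n : cancel (@lunit_fun n) (@lunitV_fun n).
Proof.
by move=> k; case: (mxtens_indexP k) => i j; rewrite funE (ord1 i).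
Qed.

Lemma lunitV_funK n : cancel (@lunitV_fun n) (@lunit_fun n).
Proof. by move=> k; rewrite /lunitV_fun funE. Qed.

Lemma runit_funK n : cancel (@runit_fun n) (@runitV_fun n).
Proof.
by move=> k; case: (mxtens_indexP k) => i j; rewrite funE (ord1 j).
Qed.

Lemma runitV_funK n : cancel (@runitV_fun n) (@runit_fun n).
Proof. by move=> k; rewrite /runitV_fun funE. Qed.

Lemma braid_funK m n : cancel (@braid_fun m n) (@braid_fun n m).
Proof. by move=> k; case: (mxtens_indexP k) => i j; rewrite !funE. Qed.

Lemma assoc_mx_nat m m' n n' p p'
    (A : 'M[K]_(m, m')) (B : 'M[K]_(n, n')) (D : 'M[K]_(p, p')) :
  ((A *t B) *t D) *m fmx (@assoc_fun m' n' p') =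
  fmx (@assoc_fun m n p) *m (A *t (B *t D)).
Proof.
apply: fmx_nat (@assoc_funK _ _ _) (@assocV_funK _ _ _) _ => i k.
case: (mxtens_indexP i) => ij i3; case: (mxtens_indexP ij) => i1 i2.
case: (mxtens_indexP k) => kl k3; case: (mxtens_indexP kl) => k1 k2.
by rewrite !funE !tensmxE mulrA.
Qed.

Lemma lunit_mx_nat m n (A : 'M[K]_(m, n)) :
  ((1%:M : 'M[K]_1) *t A) *m fmx (@lunit_fun n) = fmx (@lunit_fun m) *m A.
Proof.
apply: fmx_nat (@lunit_funK _) (@lunitV_funK _) _ => i k.
case: (mxtens_indexP i) => i1 i2; case: (mxtens_indexP k) => k1 k2.
by rewrite !funE tensmxE (ord1 i1) (ord1 k1) mxE eqxx mul1r.
Qed.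

Lemma runit_mx_nat m n (A : 'M[K]_(m, n)) :
  (A *t (1%:M : 'M[K]_1)) *m fmx (@runit_fun n) = fmx (@runit_fun m) *m A.
Proof.
apply: fmx_nat (@runit_funK _) (@runitV_funK _) _ => i k.
case: (mxtens_indexP i) => i1 i2; case: (mxtens_indexP k) => k1 k2.
by rewrite !funE tensmxE (ord1 i2) (ord1 k2) mxE eqxx mulr1.
Qed.

Lemma braid_mx_nat m m' n n' (A : 'M[K]_(m, m')) (B : 'M[K]_(n, n')) :
  (A *t B) *m fmx (@braid_fun m' n') = fmx (@braid_fun m n) *m (B *t A).
Proof.
apply: fmx_nat (@braid_funK _ _) (@braid_funK _ _) _ => i k.
case: (mxtens_indexP i) => i1 i2; case: (mxtens_indexP k) => k1 k2.
by rewrite !funE !tensmxE mulrC.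
Qed.

Variables (gT : finGroupType) (G : {group gT}).
Local Notation repG := (representation K G).
Implicit Types U V W : repG.

Definition intertwiners U V : {vspace 'M[K]_(rdegree U, rdegree V)} :=
  (\bigcap_(g in G) lker (linfun (mulmx (U g) \- mulmxr (V g))))%VS.

Lemma intertwinersP U V (A : 'M[K]_(rdegree U, rdegree V)) :
  reflect {in G, forall g, U g *m A = A *m V g} (A \in intertwiners U V).
Proof.
rewrite memvE; apply: (iffP subv_bigcapP) => AP g Gg.
  have := AP g Gg; rewrite -memvE memv_ker lfunE /= subr_eq0.
  by move/eqP.
by rewrite -memvE memv_ker lfunE /= subr_eq0 AP.
Qed.

Definition rep_hom U V : vectType K := subvs_of (intertwiners U V).

Lemma rep_homP U V (f : rep_hom U V) g :
  g \in G -> U g *m vsval f = vsval f *m V g.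
Proof. by move=> Gg; have /intertwinersP -> := subvsP f. Qed.

Definition mk_rep_hom U V A (AP : {in G, forall g, U g *m A = A *m V g}) :
  rep_hom U V := Subvs (introT (@intertwinersP U V A) AP).

Lemma rep_id_proof U : {in G, forall g, U g *m 1%:M = 1%:M *m U g}.
Proof. by move=> g _; rewrite mulmx1 mul1mx. Qed.

Definition rep_id U : rep_hom U U := mk_rep_hom (@rep_id_proof U).

Lemma rep_comp_proof U V W (g : rep_hom V W) (f : rep_hom U V) :
  {in G, forall x, U x *m (vsval f *m vsval g) = vsval f *m vsval g *m W x}.
Proof. by move=> x Gx; rewrite mulmxA rep_homP // -!mulmxA rep_homP. Qed.

Definition rep_comp U V W (g : rep_hom V W) (f : rep_hom U V) : rep_hom U W :=
  mk_rep_hom (rep_comp_proof g f).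

Definition rep_lin : linCat K.
Proof.
refine (@LinCat K repG rep_hom rep_id rep_comp _ _ _ _ _).
- by move=> U V f; apply: val_inj; rewrite /= mulmx1.
- by move=> U V f; apply: val_inj; rewrite /= mul1mx.
- by move=> U V W X h g f; apply: val_inj; rewrite /= mulmxA.
- by move=> U V W f a g h; apply: val_inj; rewrite /= mulmxDr scalemxAr.
- by move=> U V W g a f h; apply: val_inj; rewrite /= mulmxDl scalemxAl.
Defined.

Lemma rep_one_proof : mx_repr G (fun _ => 1%:M : 'M[K]_1).
Proof. by split=> // x y _ _; rewrite mulmx1. Qed.

Definition rep_one : repG := Representation (MxRepresentation rep_one_proof).

Lemma rep_tens_proof U V : mx_repr G (fun g => U g *t V g).
Proof.
split=> [|x y Gx Gy]; first by rewrite !repr_mx1 tens1mx1.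
by rewrite !repr_mxM // tensmx_mul.
Qed.

Definition rep_tens U V : repG :=
  Representation (MxRepresentation (rep_tens_proof U V)).

Lemma rep_tensm_proof U U' V V' (f : rep_hom U U') (h : rep_hom V V') :
  {in G, forall g, rep_tens U V g *m (vsval f *t vsval h) =
                   vsval f *t vsval h *m rep_tens U' V' g}.
Proof. by move=> g Gg; rewrite /= !tensmx_mul !rep_homP. Qed.

Definition rep_tensm U U' V V' (f : rep_hom U U') (h : rep_hom V V') :
    rep_hom (rep_tens U V) (rep_tens U' V') :=
  @mk_rep_hom (rep_tens U V) (rep_tens U' V') _ (rep_tensm_proof f h).

Lemma fmx_inv_proof U V (a : 'I_(rdegree U) -> 'I_(rdegree V)) b :
  cancel a b -> cancel b a ->
  {in G, forall g, U g *m fmx a = fmx a *m V g} ->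
  {in G, forall g, V g *m fmx b = fmx b *m U g}.
Proof.
move=> aK bK aP g Gg.
have ab : fmx a *m fmx b = 1%:M by rewrite fmxM fmx1.
have ba : fmx b *m fmx a = 1%:M by rewrite fmxM fmx1.
by rewrite -[LHS]mul1mx -ba -mulmxA (mulmxA (fmx a)) -aP // -mulmxA ab mulmx1.
Qed.

Lemma rep_assoc_proof U V W : {in G, forall g,
  rep_tens (rep_tens U V) W g *m fmx (@assoc_fun _ _ _) =
  fmx (@assoc_fun _ _ _) *m rep_tens U (rep_tens V W) g}.
Proof. by move=> g Gg; apply: assoc_mx_nat. Qed.

Definition rep_assoc U V W :
    rep_hom (rep_tens (rep_tens U V) W) (rep_tens U (rep_tens V W)) :=
  @mk_rep_hom (rep_tens (rep_tens U V) W) (rep_tens U (rep_tens V W)) _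
    (@rep_assoc_proof U V W).

Definition rep_assocV U V W :
    rep_hom (rep_tens U (rep_tens V W)) (rep_tens (rep_tens U V) W) :=
  @mk_rep_hom (rep_tens U (rep_tens V W)) (rep_tens (rep_tens U V) W) _
    (fmx_inv_proof (U := rep_tens (rep_tens U V) W)
       (V := rep_tens U (rep_tens V W)) (@assoc_funK _ _ _)
       (@assocV_funK _ _ _) (@rep_assoc_proof U V W)).

Lemma rep_lunit_proof U : {in G, forall g,
  rep_tens rep_one U g *m fmx (@lunit_fun _) = fmx (@lunit_fun _) *m U g}.
Proof. by move=> g Gg; apply: lunit_mx_nat. Qed.

Definition rep_lunit U : rep_hom (rep_tens rep_one U) U :=
  @mk_rep_hom (rep_tens rep_one U) U _ (@rep_lunit_proof U).

Definition rep_lunitV U : rep_hom U (rep_tens rep_one U) :=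
  @mk_rep_hom U (rep_tens rep_one U) _
    (fmx_inv_proof (U := rep_tens rep_one U) (@lunit_funK _)
       (@lunitV_funK _) (@rep_lunit_proof U)).

Lemma rep_runit_proof U : {in G, forall g,
  rep_tens U rep_one g *m fmx (@runit_fun _) = fmx (@runit_fun _) *m U g}.
Proof. by move=> g Gg; apply: runit_mx_nat. Qed.

Definition rep_runit U : rep_hom (rep_tens U rep_one) U :=
  @mk_rep_hom (rep_tens U rep_one) U _ (@rep_runit_proof U).

Definition rep_runitV U : rep_hom U (rep_tens U rep_one) :=
  @mk_rep_hom U (rep_tens U rep_one) _
    (fmx_inv_proof (U := rep_tens U rep_one) (@runit_funK _)
       (@runitV_funK _) (@rep_runit_proof U)).

Lemma rep_braid_proof U V : {in G, forall g,
  rep_tens U V g *m fmx (@braid_fun _ _) =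
  fmx (@braid_fun _ _) *m rep_tens V U g}.
Proof. by move=> g Gg; apply: braid_mx_nat. Qed.

Definition rep_braid U V : rep_hom (rep_tens U V) (rep_tens V U) :=
  @mk_rep_hom (rep_tens U V) (rep_tens V U) _ (@rep_braid_proof U V).

Lemma tensmxDl m n p q (A A' : 'M[K]_(m, n)) (B : 'M[K]_(p, q)) a :
  (a *: A + A') *t B = a *: (A *t B) + A' *t B.
Proof. by apply/matrixP=> i j; rewrite !mxE mulrDl mulrA. Qed.

Lemma tensmxDr m n p q (A : 'M[K]_(m, n)) (B B' : 'M[K]_(p, q)) a :
  A *t (a *: B + B') = a *: (A *t B) + A *t B'.
Proof. by apply/matrixP=> i j; rewrite !mxE mulrDr mulrCA. Qed.

Definition rep_mon : monCat K.
Proof.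
refine (@MonCat K rep_lin rep_one rep_tens rep_tensm rep_assoc rep_assocV
  rep_lunit rep_lunitV rep_runit rep_runitV _ _ _ _ _ _ _ _ _ _ _ _).
- by move=> U V; apply: val_inj; rewrite /= tens1mx1.
- move=> U U' U'' V V' V'' f' f g' g.
  by apply: val_inj; rewrite /= tensmx_mul.
- by move=> U U' V V' g a f f'; apply: val_inj; rewrite /= tensmxDl.
- by move=> U U' V V' f a g g'; apply: val_inj; rewrite /= tensmxDr.
- move=> U V W; split; apply: val_inj; rewrite /= fmxM fmx1 //.
    exact: assoc_funK.
  exact: assocV_funK.
- move=> U; split; apply: val_inj; rewrite /= fmxM fmx1 //.
    exact: lunit_funK.
  exact: lunitV_funK.
- move=> U; split; apply: val_inj; rewrite /= fmxM fmx1 //.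
    exact: runit_funK.
  exact: runitV_funK.
- by move=> U U' V V' W W' f g h; apply: val_inj; apply: assoc_mx_nat.
- by move=> U U' f; apply: val_inj; apply: lunit_mx_nat.
- by move=> U U' f; apply: val_inj; apply: runit_mx_nat.
- move=> U V W X; apply: val_inj => /=.
  rewrite !tens1fmx !fmxtens1 !fmxM; apply: eq_fmx => k /=.
  case: (mxtens_indexP k) => k1 k2; case: (mxtens_indexP k1) => k3 k4.
  by case: (mxtens_indexP k3) => k5 k6; rewrite !funE.
- move=> U V; apply: val_inj => /=.
  rewrite !tens1fmx !fmxtens1 !fmxM; apply: eq_fmx => k /=.
  case: (mxtens_indexP k) => k1 k2; case: (mxtens_indexP k1) => k3 k4.
  by rewrite !funE.
Defined.

Definition rep_braiding : braiding rep_mon.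
Proof.
refine (@Braiding K rep_mon rep_braid _ _ _ _).
- move=> U V; exists (rep_braid V U).
  by split; apply: val_inj; rewrite /= fmxM fmx1 // => k; apply: braid_funK.
- by move=> U U' V V' f g; apply: val_inj; apply: braid_mx_nat.
- move=> U V W; apply: val_inj => /=.
  rewrite !tens1fmx !fmxtens1 !fmxM; apply: eq_fmx => k /=.
  case: (mxtens_indexP k) => k1 k2; case: (mxtens_indexP k1) => k3 k4.
  by rewrite !funE.
- move=> U V W; apply: val_inj => /=.
  rewrite !tens1fmx !fmxtens1 !fmxM; apply: eq_fmx => k /=.
  case: (mxtens_indexP k) => k1 k2; case: (mxtens_indexP k2) => k3 k4.
  by rewrite !funE.
Defined.

End Rep.

(* D is a left dual of X; equivalently, X is a right dual of D. *)
Definition is_left_dual (K : fieldType) (C : monCat K) (X D : C)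
    (ev : mor (D ⊗ X) unitob) (coev : mor unitob (X ⊗ D)) : Prop :=
  runit X ∘ (idm X ⊗m ev) ∘ assoc X D X ∘ (coev ⊗m idm X) = lunit X /\
  lunit D ∘ (ev ⊗m idm D) ∘ assocV D X D ∘ (idm D ⊗m coev) = runit D.

(* Left duals are chosen, as they are needed to speak of the double dual. *)
Record fusionCat (K : fieldType) := FusionCat {
  fus_mon :> monCat K;
  dual : fus_mon -> fus_mon;
  ev : forall X, mor (dual X ⊗ X) unitob;
  coev : forall X, mor unitob (X ⊗ dual X);
  dualP : forall X, is_left_dual (ev X) (coev X);
  fus_rdual : forall X, exists (D : fus_mon)
    (ev' : mor (X ⊗ D) unitob) (coev' : mor unitob (D ⊗ X)),
    is_left_dual ev' coev';
  fus_abelian : abelian_cat fus_mon;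
  fus_semisimple : semisimple fus_mon;
  fus_finite : exists n, has_rank fus_mon n;
  fus_unit : bijective (fun a : K => a *: idm (@unitob K fus_mon))
}.
Arguments dual {K C} X : rename.
Arguments ev {K C} X : rename.
Arguments coev {K C} X : rename.

Section Fusion.
Variables (K : fieldType) (C : fusionCat K).
Implicit Types X Y Z W : C.

Definition transpose Z W (phi : mor (Z ⊗ W) unitob) : mor Z (dual W) :=
  lunit (dual W) ∘ (phi ⊗m idm (dual W)) ∘ assocV Z W (dual W)
    ∘ (idm Z ⊗m coev W) ∘ runitV Z.

Definition dualm X Y (f : mor X Y) : mor (dual Y) (dual X) :=
  transpose (ev Y ∘ (idm (dual Y) ⊗m f)).

(* The canonical isomorphism from Y* ⊗ X* to (X ⊗ Y)*. *)
Definition dual_tens X Y : mor (dual Y ⊗ dual X) (dual (X ⊗ Y)) :=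
  transpose (ev Y
    ∘ (idm (dual Y) ⊗m (lunit Y ∘ (ev X ⊗m idm Y) ∘ assocV (dual X) X Y))
    ∘ assoc (dual Y) (dual X) (X ⊗ Y)).

Definition cat_trace X (a : mor X (dual (dual X))) : mor unitob unitob :=
  ev (dual X) ∘ (a ⊗m idm (dual X)) ∘ coev X.

(* A monoidal natural isomorphism piv : X -> X** such that
   dim(X) = dim(X* ) for all X. Monoidality is written between X ⊗ Y and
   (Y* ⊗ X* )*, so that no inverse of dual_tens is needed. *)
Record sphericalStructure := SphericalStructure {
  piv : forall X, mor X (dual (dual X));
  piv_iso : forall X, is_iso (piv X);
  piv_nat : forall X Y (f : mor X Y),
    dualm (dualm f) ∘ piv X = piv Y ∘ f;
  piv_mon : forall X Y,
    dualm (dual_tens X Y) ∘ piv (X ⊗ Y) =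
    dual_tens (dual Y) (dual X) ∘ (piv X ⊗m piv Y);
  piv_spherical : forall X, cat_trace (piv X) = cat_trace (piv (dual X))
}.

(* Full subcategories are given by predicates on objects; closure under direct
   sums for families of length 0 and 1 yields the zero objects and closure
   under isomorphism. *)
Record is_fusion_sub (P : C -> Prop) : Prop := IsFusionSub {
  fs_one : P unitob;
  fs_tens : forall X Y, P X -> P Y -> P (X ⊗ Y);
  fs_dual : forall X, P X -> P (dual X);
  fs_dsum : forall n (Xs : 'I_n -> C) S,
    is_dsum Xs S -> (forall j, P (Xs j)) -> P S;
  fs_summand : forall X Y (i : mor X Y) (p : mor Y X),
    p ∘ i = idm X -> P Y -> P X
}.

Record fusionSub := FusionSub {
  fs_mem :> C -> Prop;
  fs_isP : is_fusion_sub fs_mem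
}.

Definition maximal_fusion_sub (P : C -> Prop) : Prop :=
  [/\ is_fusion_sub P, (exists X, ~ P X)
    & exists2 r, has_rank (sub_lin P) r & has_rank C r.+1].

Definition fs_mon (D : fusionSub) : monCat K :=
  sub_mon (fs_one (fs_isP D)) (fs_tens (fs_isP D)).

Definition fs_braiding (c : braiding C) (D : fusionSub) :
  braiding (fs_mon D) := sub_braiding _ _ c.

Definition tannakian (c : braiding C) (D : fusionSub) : Prop :=
  exists (gT : finGroupType) (G : {group gT}),
    braided_equivalent (fs_braiding c D) (rep_braiding K G).

End Fusion.

Record premodular (K : fieldType) := Premodular {
  pm_fus :> fusionCat K;
  pm_braid : braiding pm_fus;
  pm_sph : sphericalStructure pm_fus
}.
Arguments pm_braid {K} C : rename.

Section Premodular.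
Variables (K : fieldType) (C : premodular K).

Definition sym_center (X : C) : Prop :=
  forall Y : C, pm_braid C Y X ∘ pm_braid C X Y = idm (X ⊗ Y).

Definition symmetrically_braided : Prop := forall X, sym_center X.

End Premodular.

(* Main.v *)
(** Only the symmetry of [D] matters. Let [Z] be the symmetric center and
suppose that [Z] is not contained in [D]; then some simple [X] is in [Z] but
not in [D], and at most one further simple [Y] lies outside [D]. If some simple
[A] of [D] were not in [Z], then by duality no simple summand of [A ⊗ X] could
be in [D] or in [Z], so it would be [Y]. But [A] centralizes [D] and [X], hence
[A ⊗ X] and [Y], hence everything: contradiction. So [D] is contained in [Z],
and [Z] is [C] or misses exactly [Y]. That [Z] is a fusion subcategory is seen
by comparing the braiding with its reverse. *)
Require Import Defs.
From mathcomp Require Import all_boot all_algebra complex reals.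
From mathcomp Require Import boolp.
Import Defs.

Set Implicit Arguments.
Unset Strict Implicit.
Unset Printing Implicit Defensive.

Import GRing.Theory.
Local Open Scope ring_scope.
Local Open Scope cat_scope.

(** * Sums and zero under maps with an unbundled linearity property *)

Lemma linear_big (K : fieldType) (U V : lmodType K) (f : U -> V) :
  linear f -> forall I (s : seq I) (P : pred I) (E : I -> U),
  f (\sum_(i <- s | P i) E i) = \sum_(i <- s | P i) f (E i).
Proof.
move=> fl I s P E.
have fD u v : f (u + v) = f u + f v by move: (fl 1 u v); rewrite !scale1r.
have f0 : f 0 = 0 by apply: (addIr (f 0)); rewrite -fD !add0r.
exact: big_morph.
Qed.

Lemma linear_zero (K : fieldType) (U V : lmodType K) (f : U -> V) :
  linear f -> f 0 = 0.
Proof.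
move=> fl; have := linear_big fl (Nil nat) xpredT (fun=> 0).
by rewrite !big_nil.
Qed.

(** * Isomorphisms, split monomorphisms and simple objects in linear categories *)

Section LinCat.
Variables (K : fieldType) (C : linCat K).
Implicit Types X Y Z W S T : C.

Lemma comp0m X Y Z (f : mor X Y) : (0 : mor Y Z) ∘ f = 0.
Proof. exact: (linear_zero (comp_linl f)). Qed.

Lemma compm0 X Y Z (g : mor Y Z) : g ∘ (0 : mor X Y) = 0.
Proof. exact: (linear_zero (comp_linr g)). Qed.

Lemma comp_suml X Y Z n (g : 'I_n -> mor Y Z) (f : mor X Y) :
  (\sum_j g j) ∘ f = \sum_j (g j ∘ f).
Proof. exact: (linear_big (comp_linl f)). Qed.

Lemma comp_sumr X Y Z n (g : mor Y Z) (f : 'I_n -> mor X Y) :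
  g ∘ (\sum_j f j) = \sum_j (g ∘ f j).
Proof. exact: (linear_big (comp_linr g)). Qed.

Lemma compZl X Y Z a (g : mor Y Z) (f : mor X Y) :
  (a *: g) ∘ f = a *: (g ∘ f).
Proof. by have := comp_linl f a g 0; rewrite comp0m !addr0. Qed.

Lemma compBr X Y Z (g : mor Y Z) (f h : mor X Y) :
  g ∘ (f - h) = g ∘ f - g ∘ h.
Proof.
by have := comp_linr g (- 1) h f; rewrite !scaleN1r ![- _ + _]addrC.
Qed.

(** Composites nest to the left, so two adjacent factors need not form a subterm; in this form an
    equation on them can still be rewritten. *)
Lemma compAE X Y Z (g : mor Y Z) (f : mor X Y) k : g ∘ f = k ->
  forall W (h : mor Z W), h ∘ g ∘ f = h ∘ k.
Proof. by move=> <- W h; rewrite compA. Qed.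

Lemma iso_epi X Y (e : mor X Y) : is_iso e -> is_epi e.
Proof.
move=> [e' [_ ee']] Z g h gh.
by rewrite -[g]compm1 -[h]compm1 -ee' !compA gh.
Qed.

Lemma iso_mono X Y (e : mor X Y) : is_iso e -> is_mono e.
Proof.
move=> [e' [e'e _]] Z g h gh.
by rewrite -[g]comp1m -[h]comp1m -e'e -!compA gh.
Qed.

Lemma inverses_iso X Y (f : mor X Y) g : inverses f g -> is_iso f.
Proof. by exists g. Qed.

Lemma inverses_isoV X Y (f : mor X Y) g : inverses f g -> is_iso g.
Proof. by case=> gf fg; exists f. Qed.

Lemma iso_linv X Y (f : mor X Y) g : is_iso f -> g ∘ f = idm X -> f ∘ g = idm Y.
Proof. by move=> fi gf; apply: (iso_epi fi); rewrite -compA gf comp1m compm1. Qed.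

Lemma inverses_sym X Y (f : mor X Y) g : inverses f g -> inverses g f.
Proof. by case. Qed.

Lemma inverses_comp X Y Z (f : mor X Y) f' (g : mor Y Z) g' :
  inverses f f' -> inverses g g' -> inverses (g ∘ f) (f' ∘ g').
Proof.
move=> [f'f ff'] [g'g gg']; split.
  by rewrite compA (compAE g'g) compm1.
by rewrite compA (compAE ff') compm1.
Qed.

Lemma inverses_uniq X Y (f : mor X Y) g h :
  inverses f g -> inverses f h -> g = h.
Proof.
by move=> [gf _] [_ fh]; rewrite -[g]compm1 -fh compA gf comp1m.
Qed.

Lemma isomorphic_sym X Y : isomorphic X Y -> isomorphic Y X.
Proof. by case=> f [g fg]; exists g; apply: inverses_isoV fg. Qed.

Lemma isomorphic_trans X Y Z :
  isomorphic X Y -> isomorphic Y Z -> isomorphic X Z.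
Proof.
move=> [f [f' ff']] [g [g' gg']].
by exists (g ∘ f), (f' ∘ g'); apply: inverses_comp.
Qed.

Lemma is_zeroP X : is_zero X <-> idm X = 0.
Proof.
split=> [/(_ X)[X0 _]|X0 Y]; [exact: X0 | split=> f].
  by rewrite -[f]compm1 X0 compm0.
by rewrite -[f]comp1m X0 comp0m.
Qed.

Lemma mono_nonzero X Y (f : mor X Y) : is_mono f -> ~ is_zero X -> f <> 0.
Proof.
by move=> fm nX f0; apply/nX/is_zeroP/fm; rewrite compm0 f0 comp0m.
Qed.

Lemma split_mono X Y (i : mor X Y) p : p ∘ i = idm X -> is_mono i.
Proof.
by move=> pi Z g h gh; rewrite -[g]comp1m -[h]comp1m -pi -!compA gh.
Qed.

Lemma split_epi_mono_iso X Y (f : mor X Y) s :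
  is_mono f -> f ∘ s = idm Y -> is_iso f.
Proof.
move=> fm fs; exists s; split=> //; apply: fm.
by rewrite compA fs comp1m compm1.
Qed.

Lemma iso_simple X S : isomorphic X S -> simple_obj S -> simple_obj X.
Proof.
move=> [e [e' [e'e ee']]] [nS mS]; split=> [/is_zeroP X0|Y f fm].
  by apply/nS/is_zeroP; rewrite -ee' -[e]compm1 X0 compm0 comp0m.
have efm : is_mono (e ∘ f).
  move=> W g h; rewrite -!compA => /(iso_mono (inverses_iso (conj e'e ee'))).
  exact: fm.
case: (mS _ _ efm) => [|[s [_ es]]]; [by left | right].
apply: (@split_epi_mono_iso _ _ _ (s ∘ e)) => //.
by rewrite -[f]comp1m -e'e -(compA e') compA -(compA e') es compm1.
Qed.

End LinCat.

(** * Semisimple abelian categories and Schur's lemma *)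

Section Semisimple.
Variables (K : fieldType) (C : linCat K).
Implicit Types X Y Z W S T : C.
Hypothesis C_ab : abelian_cat C.
Hypothesis C_ss : semisimple C.

(** The kernel of [f] is a subobject of [S]. It is not all of [S] because [f] is nonzero, so it
    vanishes; then [f] is a monomorphism into the simple object [T]. *)
Lemma schur S T (f : mor S T) :
  simple_obj S -> simple_obj T -> f <> 0 -> is_iso f.
Proof.
move=> [nS mS] [_ mT] f0.
have [Z [k [fk ku]]] := ab_ker C_ab f.
have km : is_mono k.
  move=> W g h gh; have [|u [_ uu]] := ku W (k ∘ g).
    by rewrite compA fk comp0m.
  by rewrite -(uu g) // -(uu h).
have fm : is_mono f.
  case: (mS _ _ km) => [Z0|ki]; last first.
    by case: f0; apply: (iso_epi ki); rewrite fk comp0m.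
  move=> W g h gh; apply/eqP; rewrite -subr_eq0; apply/eqP.
  have [|u [<- _]] := ku W (g - h); first by rewrite compBr gh subrr.
  by rewrite ((Z0 W).2 u) compm0.
by case: (mT _ _ fm) => // /nS.
Qed.

Lemma dsum_ext_src n (Xs : 'I_n -> C) X Y (f g : mor X Y)
    (i : forall j, mor (Xs j) X) (p : forall j, mor X (Xs j)) :
  \sum_j (i j ∘ p j) = idm X -> (forall j, f ∘ i j = g ∘ i j) -> f = g.
Proof.
move=> ip fg; rewrite -[f]compm1 -[g]compm1 -ip !comp_sumr.
by apply: eq_bigr => j _; rewrite !compA fg.
Qed.

(** A morphism that vanishes on every term of a simple decomposition of [X] is zero. *)
Lemma nonzero_simple_summand X Y (f : mor X Y) : f <> 0 ->
  exists W (i : mor W X) (p : mor X W),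
    [/\ simple_obj W, p ∘ i = idm W & f ∘ i <> 0].
Proof.
move=> f0; have [n [Xs [Xss [i [p [pi _ ip]]]]]] := C_ss X.
apply: contrapT => nex; apply: f0; apply: (dsum_ext_src ip) => j.
rewrite comp0m; apply: contrapT => fi.
by apply: nex; exists (Xs j), (i j), (p j).
Qed.

(** * Full subcategories closed under direct summands *)

Section Sub.
Variable P : C -> Prop.
Hypothesis P_summand : forall X Y (i : mor X Y) (p : mor Y X),
  p ∘ i = idm X -> P Y -> P X.

Lemma sub_iso X Y : isomorphic X Y -> P X -> P Y.
Proof. by move=> [f [g [_ fg]]]; apply: P_summand fg. Qed.

(** Some simple summand of [Y] is not killed by [f]; by Schur it is isomorphic to [X]. *)
Lemma sub_of_nonzero X Y (f : mor Y X) : simple_obj X -> f <> 0 -> P Y -> P X.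
Proof.
move=> Xs /nonzero_simple_summand [W [i [p [Ws pi fi]]]] PY.
by apply: (sub_iso (X := W)); [exists (f ∘ i); apply: schur
                              | apply: P_summand pi PY].
Qed.

Lemma sub_zeroP (X : sub_lin P) : is_zero X <-> is_zero (sval X).
Proof.
split=> [X0|X0 Y]; last exact: (X0 (sval Y)).
by apply/is_zeroP; apply: (X0 X).1.
Qed.

(** A monomorphism of the subcategory is tested only against objects of [P], so it is not directly
    one of [C]. Both directions therefore pass through a simple summand taken in [C]: it lies in
    [P], and its inclusion is split, hence monic in either category. *)
Lemma sub_simpleP (X : sub_lin P) : simple_obj X <-> simple_obj (sval X).
Proof.
split=> [[nX mX]|[nX mX]].
  have : idm (sval X) <> 0 by move/is_zeroP/sub_zeroP.
  move=> /nonzero_simple_summand [W [i [p [Ws pi _]]]].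
  pose W' : sub_lin P := exist P W (P_summand pi (svalP X)).
  have im : @is_mono _ _ W' X i by move=> Z g h; apply: (split_mono pi).
  case: (mX _ _ im) => [/sub_zeroP/Ws.1 //|[q [qi iq]]].
  by apply: iso_simple Ws; exists q, i.
split=> [/sub_zeroP//|Y f fm].
have [/is_zeroP/sub_zeroP|] := EM (idm (sval Y) = 0); first by left.
move=> /nonzero_simple_summand [W [i [p [Ws pi _]]]]; right.
pose W' : sub_lin P := exist P W (P_summand pi (svalP Y)).
have fim : @is_mono _ _ W' X (compm (C := C) f i).
  move=> Z g h; rewrite /= -!compA => /fm.
  exact: (split_mono pi).
have nW' : ~ is_zero W' by move/sub_zeroP/Ws.1.
have [s [_ fs]] := schur Ws (conj nX mX) (mono_nonzero fim nW').
apply: (@split_epi_mono_iso _ (sub_lin P) Y X f (compm (C := C) i s) fm).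
by rewrite /= compA.
Qed.

End Sub.

(** Sending a simple object of the subcategory to its class in [C] is injective on indices, so
    exactly two indices of [C] are missed, and no object of [P] has a missed index. *)
Lemma has_rank_corank2 (P : C -> Prop) r :
  (forall X Y (i : mor X Y) (p : mor Y X), p ∘ i = idm X -> P Y -> P X) ->
  has_rank (sub_lin P) r -> has_rank C (r + 2)%N ->
  exists A B, [/\ simple_obj A, ~ P A & ~ P B] /\
    forall X, simple_obj X -> [\/ P X, isomorphic X A | isomorphic X B].
Proof.
move=> Ps [T [Ts Tinj Tall]] [S [Ss Sinj Sall]].
have [phi phiP] :=
  boolp.choice (fun i => Sall _ ((sub_simpleP Ps _).1 (Ts i))).
have phi_inj : injective phi.
  move=> i j ij; apply: Tinj; apply: isomorphic_trans (phiP i) _.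
  by rewrite ij; apply: isomorphic_sym.
have nP a : a \notin phi @: setT -> ~ P (S a).
  move=> /imsetP na Pa; apply: na.
  have [i Si] := Tall (exist P (S a) Pa)
    ((sub_simpleP Ps (exist P _ Pa)).2 (Ss a)).
  exists i => //; apply: Sinj.
  exact: (isomorphic_trans (Y := sval (T i)) Si (phiP i)).
have : #|~: (phi @: setT)| == 2.
  by rewrite -(eqn_add2l #|phi @: setT|) cardsC card_imset // cardsT !card_ord.
move/cards2P => [a [b [_ Cab]]].
have out x : x \in [set a; b] -> x \notin phi @: setT by rewrite -Cab inE.
exists (S a), (S b); split.
  by split=> //; apply/nP/out; rewrite !inE eqxx ?orbT.
move=> X /Sall [j Xj]; case: (boolP (j \in phi @: setT)) => [/imsetP[i _ ji]|].
  apply: Or31; apply: (sub_iso Ps _ (svalP (T i))).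
  by apply: isomorphic_trans (phiP i) _; rewrite -ji; apply: isomorphic_sym.
rewrite -in_setC Cab !inE => /orP[] /eqP ?; subst j; last exact: Or33.
exact: Or32.
Qed.

Lemma has_rank_adjoin (P Q : C -> Prop) r A :
  (forall X Y (i : mor X Y) (p : mor Y X), p ∘ i = idm X -> P Y -> P X) ->
  (forall X Y (i : mor X Y) (p : mor Y X), p ∘ i = idm X -> Q Y -> Q X) ->
  (forall X, P X -> Q X) -> simple_obj A -> ~ P A -> Q A ->
  (forall X, simple_obj X -> Q X -> P X \/ isomorphic X A) ->
  has_rank (sub_lin P) r -> has_rank (sub_lin Q) r.+1.
Proof.
move=> Ps Qs PQ As nPA QA QE [T [Ts Tinj Tall]].
(* Index [ord0] enumerates [A]; the lifted indices enumerate the simple objects of [P]. *)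
pose S (i : 'I_r.+1) : sub_lin Q :=
  if unlift ord0 i is Some j then exist Q (sval (T j)) (PQ _ (svalP (T j)))
  else exist Q A QA.
have nTA j : ~ isomorphic (sval (T j)) A.
  by move=> TA; apply/nPA/(sub_iso Ps TA)/(svalP (T j)).
exists S; split.
- move=> i; apply/(sub_simpleP Qs); rewrite /S.
  by case: unlift => //= j; apply/(sub_simpleP Ps).
- rewrite /S => i j; case: (unliftP ord0 i) => [i'|] ->;
    case: (unliftP ord0 j) => [j'|] -> //=.
  + by move/(Tinj i' j') ->.
  + by move/nTA.
  + by move/isomorphic_sym/nTA.
- move=> X /(sub_simpleP Qs) Xs.
  have [PX|XA] := QE _ Xs (svalP X); last first.
    by exists ord0; rewrite /S unlift_none.
  have [j Xj] := Tall (exist P (sval X) PX) ((sub_simpleP Ps (exist P _ PX)).2 Xs).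
  by exists (lift ord0 j); rewrite /S liftK.
Qed.

End Semisimple.

(** * Monoidal categories: unit coherence and duality *)

Section MonCat.
Variables (K : fieldType) (C : monCat K).
Implicit Types X Y Z W D : C.
Local Notation "1" := (@unitob K C) : cat_scope.

Lemma tens_compl X Y Z W (g : mor Y Z) (f : mor X Y) :
  (g ∘ f) ⊗m idm W = (g ⊗m idm W) ∘ (f ⊗m idm W).
Proof. by rewrite -tensm_comp comp1m. Qed.

Lemma tens_compr X Y Z W (g : mor Y Z) (f : mor X Y) :
  idm W ⊗m (g ∘ f) = (idm W ⊗m g) ∘ (idm W ⊗m f).
Proof. by rewrite -tensm_comp comp1m. Qed.

Lemma tens_interchange X X' Y Y' (f : mor X X') (g : mor Y Y') :
  (f ⊗m idm Y') ∘ (idm X ⊗m g) = (idm X' ⊗m g) ∘ (f ⊗m idm Y).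
Proof. by rewrite -!tensm_comp !comp1m !compm1. Qed.

Lemma inverses_tensl X X' Y (f : mor X X') g :
  inverses f g -> inverses (f ⊗m idm Y) (g ⊗m idm Y).
Proof. by case=> gf fg; split; rewrite -tens_compl ?gf ?fg tensm1. Qed.

Lemma inverses_tensr X X' Y (f : mor X X') g :
  inverses f g -> inverses (idm Y ⊗m f) (idm Y ⊗m g).
Proof. by case=> gf fg; split; rewrite -tens_compr ?gf ?fg tensm1. Qed.

Lemma tens_isol X X' Y (f : mor X X') : is_iso f -> is_iso (f ⊗m idm Y).
Proof. by case=> g fg; exists (g ⊗m idm Y); apply: inverses_tensl. Qed.

Lemma tens_isor X X' Y (f : mor X X') : is_iso f -> is_iso (idm Y ⊗m f).
Proof. by case=> g fg; exists (idm Y ⊗m g); apply: inverses_tensr. Qed.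

Lemma assoc_iso X Y Z : is_iso (assoc X Y Z).
Proof. exact: inverses_iso (assocK X Y Z). Qed.

Lemma assocV_iso X Y Z : is_iso (assocV X Y Z).
Proof. exact: inverses_isoV (assocK X Y Z). Qed.

Lemma lunit_iso X : is_iso (lunit X).
Proof. exact: inverses_iso (lunitK X). Qed.

Lemma runit_iso X : is_iso (runit X).
Proof. exact: inverses_iso (runitK X). Qed.

Lemma assocV_nat X X' Y Y' Z Z' (f : mor X X') (g : mor Y Y') (h : mor Z Z') :
  assocV X' Y' Z' ∘ (f ⊗m (g ⊗m h)) = (f ⊗m g ⊗m h) ∘ assocV X Y Z.
Proof.
apply: (iso_mono (assoc_iso X' Y' Z')).
rewrite !compA (assocK X' Y' Z').2 comp1m assoc_nat.
by rewrite (compAE (assocK X Y Z).2) compm1.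
Qed.

Lemma tens1_inj X Y (f g : mor X Y) : f ⊗m idm 1 = g ⊗m idm 1 -> f = g.
Proof.
by move=> fg; apply: (iso_epi (runit_iso X)); rewrite -!runit_nat fg.
Qed.

Lemma one_tens_inj X Y (f g : mor X Y) : idm 1 ⊗m f = idm 1 ⊗m g -> f = g.
Proof.
by move=> fg; apply: (iso_epi (lunit_iso X)); rewrite -!lunit_nat fg.
Qed.

(* Kelly: tensor with the unit and compare both sides through the pentagon
   for (1, 1, X, Y). *)
Lemma lunit_assoc X Y : lunit (X ⊗ Y) ∘ assoc 1 X Y = lunit X ⊗m idm Y.
Proof.
apply: one_tens_inj; apply: (iso_epi (assoc_iso 1 (1 ⊗ X) Y)).
apply: (iso_epi (tens_isol Y (assoc_iso 1 1 X))).
rewrite tens_compr -2!compA (compA (idm 1 ⊗m assoc 1 X Y)) -pentagon compA.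
rewrite triangle -[idm (X ⊗ Y)]tensm1 -!assoc_nat -!compA -!tens_compl.
by rewrite triangle.
Qed.

(* The maps compared are the mates of [f] and [g] under the adjunction between
   [- ⊗ X] and [- ⊗ D]. *)
Lemma mate_inj X D ev coev : @is_left_dual K C X D ev coev ->
  forall W Y (f g : mor W (Y ⊗ D)),
  (idm Y ⊗m ev) ∘ assoc Y D X ∘ (f ⊗m idm X) =
  (idm Y ⊗m ev) ∘ assoc Y D X ∘ (g ⊗m idm X) -> f = g.
Proof.
move=> [_ zz] W Y f g.
pose mate h : mor (W ⊗ X) (Y ⊗ 1) :=
  (idm Y ⊗m ev) ∘ assoc Y D X ∘ (h ⊗m idm X).
(* The mate determines [h]: tensoring with [D] and inserting [coev] recovers [h ⊗m idm 1] up to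
   constraints, by the second zigzag identity. *)
have mateE h : (idm Y ⊗m lunit D) ∘ assoc Y 1 D ∘ (mate h ⊗m idm D)
    ∘ assocV W X D ∘ (idm W ⊗m coev) =
    (idm Y ⊗m runit D) ∘ assoc Y D 1 ∘ (h ⊗m idm 1).
  rewrite /mate !tens_compl !compA.
  rewrite (compAE (esym (assocV_nat h (idm X) (idm D)))) tensm1 !compA.
  rewrite (compAE (tens_interchange h coev)) !compA.
  congr (_ ∘ _); rewrite (compAE (assoc_nat _ _ _)) !compA.
  rewrite -tens_compr.
  (* This is the pentagon for [Y], [D], [X], [D] with two associators moved across; the prefix [k]
     lets it rewrite inside a longer composite. *)
  have pent V (k : mor _ V) : k ∘ assoc Y (D ⊗ X) D ∘ (assoc Y D X ⊗m idm D)
      ∘ assocV (Y ⊗ D) X D =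
      k ∘ ((idm Y ⊗m assocV D X D) ∘ assoc Y D (X ⊗ D)).
    rewrite -!(compA k); congr (_ ∘ _).
    apply: (iso_epi (assoc_iso (Y ⊗ D) X D)).
    rewrite (compAE (assocK _ _ _).1) compm1 -compA pentagon !compA.
    by rewrite -tens_compr (assocK D X D).1 tensm1 comp1m.
  rewrite pent !compA -tens_compr -(compA _ (assoc _ _ _)) -[idm (Y ⊗ D)]tensm1.
  by rewrite assoc_nat compA -tens_compr zz.
move=> fg; have fg' : mate f = mate g by [].
have := mateE f; rewrite fg' mateE -!(compA (_ ⊗m runit D)).
move/(iso_mono (tens_isor Y (runit_iso D))).
by move/(iso_mono (assoc_iso Y D 1))/esym/tens1_inj.
Qed.

End MonCat.

(** * Braidings, the reverse braiding and centralizing pairs *)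

Section Braided.
Variables (K : fieldType) (C : monCat K).
Implicit Types X Y Z W D : C.
Local Notation "1" := (@unitob K C) : cat_scope.

(** After tensoring with the unit, this follows from the first hexagon for [X], [1], [1] and
    naturality of the braiding at [lunit 1]. Consequently all braidings agree on [X ⊗ 1]. *)
Lemma braid_unitr (c : braiding C) X : lunit X ∘ c X 1 = runit X.
Proof.
apply: tens1_inj; apply: (iso_mono (braid_iso c X 1)).
rewrite tens_compl -triangle -lunit_assoc !compA.
rewrite -lunit_nat -2!compA (compA (_ ⊗m _)) -hexagon1 !compA lunit_assoc.
by rewrite braid_nat.
Qed.

(** Compare mates. By the second hexagon for [D], [X], [Y] and naturality at [ev], the mate of
    [c D Y], precomposed with [c X Y], involves the braiding only at the unit. Since [c] and [d]
    agree at the unit and at [X], the mates agree. *)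
Lemma braid_dual_eq (c d : braiding C) X D ev coev Y :
  is_left_dual (X := X) (D := D) ev coev ->
  c 1 Y = d 1 Y -> c X Y = d X Y -> c D Y = d D Y.
Proof.
move=> XD e1 eX; apply: (mate_inj XD).
apply: (iso_epi (assocV_iso D Y X)).
apply: (iso_epi (tens_isor D (braid_iso c X Y))).
have mateE (b : braiding C) : (idm Y ⊗m ev) ∘ assoc Y D X
    ∘ (b D Y ⊗m idm X) ∘ assocV D Y X ∘ (idm D ⊗m b X Y) =
    b 1 Y ∘ (ev ⊗m idm Y) ∘ assocV D X Y.
  rewrite -2!compA (compA (_ ⊗m idm X)) -hexagon2 !compA.
  by rewrite (compAE (assocK Y D X).2) compm1 braid_nat.
by rewrite mateE e1 {1}eX mateE.
Qed.

(** The inverse of [c Y X], extracted by choice because [braid_iso] only asserts that one exists. *)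
Definition rev_braid (c : braiding C) X Y : mor (X ⊗ Y) (Y ⊗ X) :=
  sval (cid (braid_iso c Y X)).

Lemma rev_braidK (c : braiding C) X Y : inverses (c Y X) (rev_braid c X Y).
Proof. exact: svalP (cid (braid_iso c Y X)). Qed.

Lemma rev_braid_nat (c : braiding C) X X' Y Y' (f : mor X X') (g : mor Y Y') :
  rev_braid c X' Y' ∘ (f ⊗m g) = (g ⊗m f) ∘ rev_braid c X Y.
Proof.
apply: (iso_mono (braid_iso c Y' X')).
rewrite !compA (rev_braidK c X' Y').2 comp1m braid_nat.
by rewrite (compAE (rev_braidK c X Y).2) compm1.
Qed.

(** Reversal exchanges the hexagons: both sides are inverse to the same map, written in two ways by
    the second hexagon of [c]. *)
Lemma rev_hexagon1 (c : braiding C) X Y Z :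
  assoc Y Z X ∘ rev_braid c X (Y ⊗ Z) ∘ assoc X Y Z =
  (idm Y ⊗m rev_braid c X Z) ∘ assoc Y X Z ∘ (rev_braid c X Y ⊗m idm Z).
Proof.
apply: (inverses_uniq (f := assocV X Y Z ∘ c (Y ⊗ Z) X ∘ assocV Y Z X)).
  rewrite -(compA (assoc _ _ _)).
  apply: inverses_comp (inverses_sym (assocK _ _ _)) _.
  exact: inverses_comp (rev_braidK _ _ _) (inverses_sym (assocK _ _ _)).
rewrite hexagon2 -(compA (_ ⊗m rev_braid _ _ _)).
apply: inverses_comp (inverses_tensr _ (rev_braidK c X Z)) _.
apply: inverses_comp (inverses_sym (assocK _ _ _)) _.
exact/inverses_tensl/rev_braidK.
Qed.

Lemma rev_hexagon2 (c : braiding C) X Y Z :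
  assocV Z X Y ∘ rev_braid c (X ⊗ Y) Z ∘ assocV X Y Z =
  (rev_braid c X Z ⊗m idm Y) ∘ assocV X Z Y ∘ (idm X ⊗m rev_braid c Y Z).
Proof.
apply: (inverses_uniq (f := assoc X Y Z ∘ c Z (X ⊗ Y) ∘ assoc Z X Y)).
  rewrite -(compA (assocV _ _ _)); apply: inverses_comp (assocK _ _ _) _.
  exact: inverses_comp (rev_braidK _ _ _) (assocK _ _ _).
rewrite hexagon1 -(compA (rev_braid _ _ _ ⊗m _)).
apply: inverses_comp (inverses_tensl _ (rev_braidK c X Z)) _.
apply: inverses_comp (assocK _ _ _) _.
exact/inverses_tensr/rev_braidK.
Qed.

Definition rev_braiding (c : braiding C) : braiding C :=
  Braiding (fun X Y => inverses_isoV (rev_braidK c X Y)) (@rev_braid_nat c)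
    (@rev_hexagon1 c) (@rev_hexagon2 c).

(* As an equality between two braidings, centralizing [Y] propagates by
   naturality and the hexagons. *)
Lemma centralizerP (c : braiding C) X Y :
  c Y X ∘ c X Y = idm (X ⊗ Y) <-> c X Y = rev_braiding c X Y.
Proof.
have rK := rev_braidK c X Y; split=> [cc | ->]; last exact: rK.2.
apply: (iso_mono (braid_iso c Y X)); rewrite cc.
by rewrite rK.2.
Qed.

Lemma centralizer_sym (c : braiding C) X Y :
  c Y X ∘ c X Y = idm (X ⊗ Y) -> c X Y ∘ c Y X = idm (Y ⊗ X).
Proof. exact/iso_linv/braid_iso. Qed.

(** [braid_unitr] holds for [c] and for its reverse, which therefore agree on [Y ⊗ 1]. *)
Lemma centralizer_unit (c : braiding C) Y : c Y 1 ∘ c 1 Y = idm (1 ⊗ Y).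
Proof.
apply/centralizer_sym/centralizerP/(iso_mono (lunit_iso Y)).
by rewrite !braid_unitr.
Qed.

End Braided.

(** * Fusion categories: centralizers, simplicity of the unit, nonzero tensor products *)

Section FusionCat.
Variables (K : fieldType) (C : fusionCat K) (c : braiding C).
Implicit Types X Y Z W : C.

(** Where [c] and its reverse agree is stable under tensor products by the second hexagon, under
    duals by [braid_dual_eq], and under sums and summands by naturality. A single [Y] is fixed
    because centralizers of one object are needed besides the symmetric center. *)
Lemma centralizer_fusion_sub Y :
  is_fusion_sub (fun X : C => c Y X ∘ c X Y = idm (X ⊗ Y)).
Proof.
split.
- exact: centralizer_unit.
- move=> X Z /centralizerP cX /centralizerP cZ; apply/centralizerP.
  apply: (iso_epi (assocV_iso X Z Y)); apply: (iso_mono (assocV_iso Y X Z)).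
  by rewrite !compA !hexagon2 cX cZ.
- move=> X /centralizerP cX; apply/centralizerP.
  apply: braid_dual_eq (dualP X) _ cX.
  exact/centralizerP/centralizer_unit.
- move=> n Xs S [i [p [_ _ ip]]] cX; apply/centralizerP.
  have ipY : \sum_j ((i j ⊗m idm Y) ∘ (p j ⊗m idm Y)) = idm (S ⊗ Y).
    rewrite -tensm1 -ip (linear_big (tensm_linl (idm Y))).
    by apply: eq_bigr => j _; rewrite -tens_compl.
  apply: (dsum_ext_src ipY) => j.
  by rewrite !braid_nat; have /centralizerP-> := cX j.
- move=> X Z i p pi /centralizerP cZ; apply/centralizerP.
  apply: (split_mono (i := idm Y ⊗m i) (p := idm Y ⊗m p)).
    by rewrite -tens_compr pi tensm1.
  by rewrite -!braid_nat cZ.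
Qed.

(** The flip of representations is an involution, and a faithful braided functor reflects this. *)
Lemma tannakian_symmetric (D : fusionSub C) : tannakian c D ->
  forall X Y, D X -> D Y -> c Y X ∘ c X Y = idm (X ⊗ Y).
Proof.
move=> [gT [G [F [Fbij _]]]] X Y DX DY.
pose X' : fs_mon D := exist _ X DX; pose Y' : fs_mon D := exist _ Y DY.
pose b : braiding (fs_mon D) := fs_braiding c D.
apply: (bij_inj (Fbij (X' ⊗ Y') (X' ⊗ Y'))).
(* Composition and braiding in the full subcategory are convertible to those of [C]. *)
change (fmap F (b Y' X' ∘ b X' Y') = fmap F (idm (X' ⊗ Y'))).
apply: (iso_epi (fmu_iso F X' Y')).
rewrite fmap_comp -compA fmu_braid compA fmu_braid -compA fmap1 comp1m.
rewrite -[RHS]compm1; congr (_ ∘ _).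
by apply: val_inj; rewrite /= fmxM fmx1 // => k; apply: braid_funK.
Qed.

(** Endomorphisms of the unit are scalars, so the projection [i ∘ p] onto a simple summand is a
    nonzero idempotent scalar, hence the identity. *)
Lemma unit_simple : simple_obj (unitob : C).
Proof.
have id0 : idm (unitob : C) <> 0.
  move=> id0; have /eqP := oner_eq0 K; apply.
  by apply: (bij_inj (fus_unit C)); rewrite id0 !scaler0.
have [W [i [p [Ws pi _]]]] := nonzero_simple_summand (@fus_semisimple K C) id0.
apply: (iso_simple _ Ws); exists p.
have [s _ sK] := fus_unit C; set a := s (i ∘ p).
have ipE : i ∘ p = a *: idm _ by rewrite -(sK (i ∘ p)).
have a0 : a != 0.
  apply/eqP => a0; apply/Ws.1/is_zeroP.
  rewrite -[idm W]comp1m -pi -compA (compA i) ipE a0 scale0r comp0m.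
  by rewrite compm0.
exists i; split=> //; apply: (scalerI a0); rewrite -ipE.
by rewrite -[in LHS](comp1m (i ∘ p)) -compZl -ipE compA (compAE pi) compm1.
Qed.

(** Closure under direct sums reduces membership questions to simple objects. *)
Lemma not_sub_summand (P : C -> Prop) X : is_fusion_sub P -> ~ P X ->
  exists W (i : mor W X) (p : mor X W),
    [/\ simple_obj W, p ∘ i = idm W & ~ P W].
Proof.
move=> fP nPX; have [n [Xs [Xss Xd]]] := fus_semisimple X.
apply: contrapT => nex; apply/nPX/(fs_dsum fP Xd) => j.
apply: contrapT => nPj; apply: nex; have [i [p [pi _ _]]] := Xd.
by exists (Xs j), (i j), (p j).
Qed.

(** Since the unit is simple, the nonzero map [coev Y] has a left inverse, so [X] is up to
    constraints a retract of [X ⊗ Y ⊗ dual Y]. *)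
Lemma tens_nonzero X Y : ~ is_zero X -> ~ is_zero Y -> ~ is_zero (X ⊗ Y).
Proof.
move=> nX nY XY0.
have coev0 : coev Y <> 0.
  move=> coev0; have [zz _] := dualP Y; apply/nY/is_zeroP.
  apply: (iso_epi (lunit_iso Y)); rewrite comp0m comp1m -zz coev0.
  by rewrite (linear_zero (tensm_linl (idm Y))) compm0.
(* Some projection to a simple summand does not kill [coev Y]; the composite is invertible by
   Schur. *)
have [q qE] : exists q, q ∘ coev Y = idm unitob.
  have [n [Xs [Xss [i' [p' [_ _ ip]]]]]] := fus_semisimple (Y ⊗ dual Y).
  have [j pj] : exists j, p' j ∘ coev Y <> 0.
    apply: contrapT => nex; apply: coev0; rewrite -[coev Y]comp1m -ip.
    rewrite comp_suml big1 // => j _; rewrite -compA.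
    have [-> | pj] := EM (p' j ∘ coev Y = 0); first by rewrite compm0.
    by case: nex; exists j.
  have [q [qp _]] := schur (fus_abelian C) unit_simple (Xss j) pj.
  by exists (q ∘ p' j); rewrite -compA.
apply/nX/is_zeroP; apply: (iso_epi (runit_iso X)); rewrite comp0m comp1m.
rewrite -[runit X]compm1 -tensm1 -qE tens_compr.
rewrite -[idm X ⊗m coev Y]comp1m -(assocK X Y (dual Y)).2.
have XYD0 : is_zero (X ⊗ Y ⊗ dual Y).
  apply/is_zeroP; rewrite -tensm1; have /is_zeroP -> := XY0.
  exact: (linear_zero (tensm_linl _)).
by rewrite ((XYD0 _).1 (assoc _ _ _)) !comp0m !compm0.
Qed.

End FusionCat.

(** * The symmetric center and summands of tensor products *)

Section Premodular.
Variables (K : fieldType) (C : premodular K).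
Implicit Types X Y Z W A : C.
Local Notation c := (pm_braid C).
Let C_ss := @fus_semisimple K C.
Let C_ab := fus_abelian C.

Lemma sym_center_fusion_sub : is_fusion_sub (@sym_center K C).
Proof.
have cF := centralizer_fusion_sub c.
split=> [Y|X Z cX cZ Y|X cX Y|n Xs S Sd cX Y|X Z i p pi cZ Y].
- exact: (fs_one (cF Y)).
- exact: (fs_tens (cF Y) (cX Y) (cZ Y)).
- exact: (fs_dual (cF Y) (cX Y)).
- exact: (fs_dsum (cF Y) Sd (fun j => cX j Y)).
- exact: (fs_summand (cF Y) pi (cZ Y)).
Qed.

(** Duality turns [i] into a nonzero map from [W ⊗ dual A], an object of [P], to the simple object
    [X]. *)
Lemma sub_of_tens_summand (P : C -> Prop) X A W (i : mor W (X ⊗ A)) :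
  is_fusion_sub P -> simple_obj X -> i <> 0 -> P A -> P W -> P X.
Proof.
move=> fP Xs i0 PA PW; have pivi := piv_iso (pm_sph C) A.
(* The pivotal isomorphism replaces [A] by the chosen left dual of [dual A], so that [ev (dual A)]
   can be used to form the mate. *)
pose f := (idm X ⊗m piv (pm_sph C) A) ∘ i.
have f0 : f <> 0.
  by move=> f0; apply/i0/(iso_mono (tens_isor X pivi)); rewrite compm0.
pose g := runit X ∘ ((idm X ⊗m ev (dual A)) ∘
  assoc X (dual (dual A)) (dual A) ∘ (f ⊗m idm (dual A))).
apply: (sub_of_nonzero C_ab C_ss (fs_summand fP) (f := g)) => //.
  move=> g0; apply: f0; apply: (mate_inj (dualP (dual A))).
  apply: (iso_mono (runit_iso X)); rewrite -/g g0.
  by rewrite (linear_zero (tensm_linl _)) !compm0.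
exact: (fs_tens fP PW (fs_dual fP PA)).
Qed.

Lemma tens_summand_notin (P : C -> Prop) X A W (i : mor W (A ⊗ X)) :
  is_fusion_sub P -> simple_obj X -> i <> 0 -> P A -> ~ P X -> ~ P W.
Proof.
move=> fP Xs i0 PA nPX PW; apply: nPX.
apply: (sub_of_tens_summand (i := c A X ∘ i) fP Xs _ PA PW) => ci0.
by apply/i0/(iso_mono (braid_iso c A X)); rewrite compm0.
Qed.

Lemma symmetric_sub_sym_center (D : fusionSub C) X Y :
  (forall A B, D A -> D B -> c B A ∘ c A B = idm (A ⊗ B)) ->
  simple_obj X -> ~ D X -> sym_center X ->
  (forall W, simple_obj W -> [\/ D W, isomorphic W X | isomorphic W Y]) ->
  forall A, D A -> sym_center A.
Proof.
move=> Dsym Xs nDX ZX all A' DA'; have fZ := sym_center_fusion_sub.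
(* A noncentral object of [D] has a noncentral simple summand, which is again in [D]. *)
apply: contrapT => /(not_sub_summand fZ) [A [iA [pA [As piA nZA]]]].
have DA : D A := fs_summand (fs_isP D) piA DA'.
have cF := centralizer_fusion_sub c A.
have AX0 : idm (A ⊗ X) <> 0.
  by move/is_zeroP; apply: tens_nonzero; [case: As | case: Xs].
have [W [i [p [Ws pi]]]] := nonzero_simple_summand C_ss AX0.
rewrite comp1m => i0.
have nDW : ~ D W := tens_summand_notin (fs_isP D) Xs i0 DA nDX.
(* If [W] were central, duality against the central object [X] would make [A] central. *)
have nZW : ~ sym_center W.
  by move=> ZW; apply: nZA; apply: sub_of_tens_summand fZ As i0 ZX ZW.
(* The centralizer of [A] contains [A], as [D] is symmetric, and [X], as [X] is central. *)
have cW : c A W ∘ c W A = idm (W ⊗ A).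
  apply: (fs_summand cF pi); apply: (fs_tens cF); last exact: ZX.
  exact: Dsym.
(* [W] is neither in [D] nor isomorphic to the central [X], so it is isomorphic to [Y]. *)
have cY : c A Y ∘ c Y A = idm (Y ⊗ A).
  have [//|WX|WY] := all W Ws; last exact: (sub_iso (fs_summand cF) WY cW).
  by case: nZW; apply: (sub_iso (fs_summand fZ) (isomorphic_sym WX)).
apply: nZA => B; apply/centralizer_sym; apply: contrapT.
move=> /(not_sub_summand cF) [V [_ [_ [Vs _ nV]]]]; apply: nV.
have [DV|VX|VY] := all V Vs; first exact: Dsym.
  exact: (sub_iso (fs_summand cF) (isomorphic_sym VX) (ZX A)).
exact: (sub_iso (fs_summand cF) (isomorphic_sym VY) cY).
Qed.

End Premodular.

Theorem lemma5p3 (R : realType) (C : premodular R[i]) (D : fusionSub C)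
    (D_tannakian : tannakian (pm_braid C) D)
    (r : nat) (rank_D : has_rank (sub_lin D) r) (rank_C : has_rank C (r + 2)) :
  [\/ symmetrically_braided C,
      [/\ (forall X : C, D X -> sym_center X),
          (exists X : C, sym_center X /\ ~ D X)
        & maximal_fusion_sub (@sym_center R[i] C)]
    | forall X : C, sym_center X -> D X].
Proof.
have C_ab := fus_abelian C; have C_ss := @fus_semisimple _ C.
have fD := fs_isP D; have fZ := @sym_center_fusion_sub _ C.
have Dsym := tannakian_symmetric D_tannakian.
have [[X0 [ZX0 nDX0]]|ZD] := EM (exists X : C, sym_center X /\ ~ D X); last first.
  by apply: Or33 => X ZX; apply: contrapT => nDX; apply: ZD; exists X.
have [X [iX [pX [Xs piX nDX]]]] := not_sub_summand fD nDX0.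
have ZX : sym_center X := fs_summand fZ piX ZX0.
(* [X] is one of the two simple classes outside [D]; [Y] represents the other. *)
have [Y nDY all] : exists2 Y, ~ D Y & forall W, simple_obj W ->
    [\/ D W, isomorphic W X | isomorphic W Y].
  have [A [B [[As nDA nDB] all]]] :=
    has_rank_corank2 C_ab C_ss (fs_summand fD) rank_D rank_C.
  have [//|XA|XB] := all X Xs.
    exists B => // W /all [DW|WA|WB]; [exact: Or31 | apply: Or32 | exact: Or33].
    exact: isomorphic_trans WA (isomorphic_sym XA).
  exists A => // W /all [DW|WA|WB]; [exact: Or31 | exact: Or33 | apply: Or32].
  exact: isomorphic_trans WB (isomorphic_sym XB).
have DZ := symmetric_sub_sym_center Dsym Xs nDX ZX all.
(* Once [D] and [X] are central, [Y] decides between the first two alternatives. *)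
have [ZY|nZY] := EM (sym_center Y).
  apply: Or31 => V; apply: contrapT => /(not_sub_summand fZ).
  move=> [W [_ [_ [Ws _ nZW]]]]; apply: nZW; case: (all W Ws) => [/DZ //|WX|WY].
    exact: (sub_iso (fs_summand fZ) (isomorphic_sym WX)).
  exact: (sub_iso (fs_summand fZ) (isomorphic_sym WY)).
(* [X] witnesses that [D] is strictly smaller than the center, and [Y] that the center is proper. *)
apply: Or32; split=> //; first by exists X.
split=> //; first by exists Y.
(* The simple objects of the center are those of [D] together with [X]. *)
exists r.+1; last by rewrite -addn2.
apply: (has_rank_adjoin C_ab C_ss (fs_summand fD) (fs_summand fZ) DZ Xs nDX ZX)
  rank_D.
move=> W Ws ZW; case: (all W Ws) => [|| WY]; [by left | by right |].
by case: nZY; apply: (sub_iso (fs_summand fZ) WY).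
Qed.
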